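(* Let $L_\gamma=L_{\gamma_t}$ be a monotone equivariant Lagrangian mean curvature flow (of embedded tori) in $\mathbb{CP}^2$ with a finite-time singularity at the origin at time $T<\infty$. Suppose the type I blow-up is the cone $C^0_{\pi/2}$ and the connected component converging to $C^0_{\pi/2}$ intersects the real axis. Then for any $R>0$, $\varepsilon_0>0$, $\delta>0$, there exist $\varepsilon$ with $0<\varepsilon<\varepsilon_0$ and a time $t'$ with $T-\delta<t'<T$ such that $L_\gamma\cap B_R$ intersects $C^0_{\pi/2+2\varepsilon}$ at the time $t'$ (i.e. $\gamma_{t'}\cap B_R\cap C^0_{\pi/2+2\varepsilon}\neq\emptyset$), where $B_R:=B_R(0)$ is the ball of Euclidean radius $R$ at the origin.
   Context: $\mathbb{CP}^2$ carries the Fubini--Study metric normalised to have Einstein constant $\kappa=6$; a Lagrangian $L$ is monotone if $\kappa\int_D\omega=\pi\mu(D)$ for every disc $D\in\pi_2(\mathbb{CP}^2,L)$ ($\mu$ the Maslov class). For $\gamma\subset\mathbb{C}$ put $L_\gamma=\{[ze^{i\alpha}:ze^{-i\alpha}:1]:z\in\gamma,\ \alpha\in\mathbb{R}\}$; $L_\gamma$ is equivariant if $\gamma=-\gamma$ and $\gamma$ is invariant under complex conjugation. For an embedded equivariant torus, $\gamma\subset\mathbb{C}\setminus\{0\}$ is either one embedded closed curve enclosing $0$ or the union $\gamma_0\cup(-\gamma_0)$ of two disjoint embedded closed curves neither enclosing $0$. Equivariance is preserved by mean curvature flow. ''The origin'' is $[0:0:1]$, i.e. $0\in\mathbb{C}$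 for profile curves; distances are Euclidean in the profile plane. Let $l_b=\{\rho e^{ib}:\rho\in\mathbb{R}\}$ and $C^b_a=l_{b-a/2}\cup l_{b+a/2}$ for $a\in(0,\pi)$. The same symbol denotes the Lagrangian cone $\{(ze^{i\alpha},ze^{-i\alpha}):z\in C^b_a\}\subset\mathbb{C}^2$. Type I blow-up: for $\lambda_j\to\infty$, the rescaled flows $L^{j}_s=\lambda_j L_{\gamma_{T+\lambda_j^{-2}s}}$, $s<0$ (in coordinates centred at $[0:0:1]$), converge subsequentially as Radon measures to a weak limit flow, called a type I blow-up. The connected components in question are connected components of $L^j_s\cap B_{4\rho}(0)$ that meet $B_\rho(0)$, for a given $\rho>0$; ''intersects the real axis'' refers to their profile curves in $\mathbb{C}$. *)

(* Defs.v *)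
From Stdlib Require Import Reals List ClassicalEpsilon.
From Coquelicot Require Import Coquelicot.
Open Scope R_scope.

(** * Smooth functions of two real variables *)

(* On an open [D]: a function is C^k iff it is continuous and has partial
   derivatives that are C^(k-1). *)
Fixpoint Ck (k : nat) (D : R -> R -> Prop) (f : R -> R -> R) : Prop :=
  (forall x y, D x y -> continuity_2d_pt f x y) /\
  match k with
  | O => True
  | S k' =>
      exists f1 f2 : R -> R -> R,
        (forall x y, D x y ->
           is_derive (fun s => f s y) x (f1 x y) /\
           is_derive (fun s => f x s) y (f2 x y)) /\
        Ck k' D f1 /\ Ck k' D f2
  end.

Definition smooth_on (D : R -> R -> Prop) (f : R -> R -> R) : Prop :=
  forall k, Ck k D f.

Definition Csmooth_on (D : R -> R -> Prop) (f : R -> R -> C) : Prop :=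
  smooth_on D (fun x y => Re (f x y)) /\ smooth_on D (fun x y => Im (f x y)).

(** * C^2 and C^3 *)

Definition C2 : Type := (C * C)%type.
Definition C3 : Type := (C2 * C)%type.

Definition add2 (v w : C2) : C2 := (fst v + fst w, snd v + snd w)%C.
Definition scal2 (a : C) (v : C2) : C2 := (a * fst v, a * snd v)%C.
Definition sub2 (v w : C2) : C2 := add2 v (scal2 (RtoC (-1)) w).

Definition herm2 (v w : C2) : C :=
  (fst v * Cconj (fst w) + snd v * Cconj (snd w))%C.
Definition herm3 (V W : C3) : C :=
  (herm2 (fst V) (fst W) + snd V * Cconj (snd W))%C.

Definition det3 (U V W : C3) : C :=
  let '(u1, u2, u3) := U in
  let '(v1, v2, v3) := V in
  let '(w1, w2, w3) := W in
  (u1 * (v2 * w3 - v3 * w2) - u2 * (v1 * w3 - v3 * w1)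
   + u3 * (v1 * w2 - v2 * w1))%C.

(* Derivative of a curve with respect to its real parameter. *)
Definition dC (f : R -> C) (x : R) : C :=
  (Derive (fun s => Re (f s)) x, Derive (fun s => Im (f s)) x).
Definition dC2 (f : R -> C2) (x : R) : C2 :=
  (dC (fun s => fst (f s)) x, dC (fun s => snd (f s)) x).
Definition dC3 (f : R -> C3) (x : R) : C3 :=
  (dC2 (fun s => fst (f s)) x, dC (fun s => snd (f s)) x).

Definition d1 (X : R -> R -> C2) (u a : R) : C2 := dC2 (fun s => X s a) u.
Definition d2 (X : R -> R -> C2) (u a : R) : C2 := dC2 (fun s => X u s) a.

(** * The Fubini--Study structure of CP^2 *)

(* The Hermitian form on C^3 \ {0} pulled back from CP^2, where CP^2 is the
   quotient of the unit sphere S^5: the metric satisfies Ric = 6 g and a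
   projective line has area PI. *)
Definition fs_herm (Z V W : C3) : C :=
  ((herm3 Z Z * herm3 V W - herm3 V Z * herm3 Z W) / (herm3 Z Z * herm3 Z Z))%C.

Definition fs_form (Z V W : C3) : R := - Im (fs_herm Z V W).

(* The affine chart (x, y) |-> [x : y : 1].  All the L_gamma lie in it. *)
Definition chart (p : C2) : C3 := (p, RtoC 1).
Definition chart_tangent (v : C2) : C3 := (v, RtoC 0).

Definition fs_metric (p v w : C2) : R :=
  Re (fs_herm (chart p) (chart_tangent v) (chart_tangent w)).

(* Christoffel term of the Levi-Civita connection in the affine chart:
   Gamma^i_{jk} = - (delta^i_j conj p_k + delta^i_k conj p_j) / (1 + |p|^2). *)
Definition fs_christoffel (p v w : C2) : C2 :=
  scal2 (- / (1 + herm2 p p))%C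
    (add2 (scal2 (herm2 v p) w) (scal2 (herm2 w p) v)).

(** * Extrinsic geometry of an immersed surface X(u, a), read in the chart *)

Definition gE (X : R -> R -> C2) u a := fs_metric (X u a) (d1 X u a) (d1 X u a).
Definition gF (X : R -> R -> C2) u a := fs_metric (X u a) (d1 X u a) (d2 X u a).
Definition gG (X : R -> R -> C2) u a := fs_metric (X u a) (d2 X u a) (d2 X u a).

(* Entries of the inverse of the first fundamental form. *)
Definition ginv (X : R -> R -> C2) (u a : R) (i j : bool) : R :=
  let dt := gE X u a * gG X u a - gF X u a * gF X u a in
  match i, j with
  | false, false => gG X u a / dt
  | true, true => gE X u a / dt
  | _, _ => - gF X u a / dt
  end.

Definition tangent (X : R -> R -> C2) (u a : R) (i : bool) : C2 :=
  if i then d2 X u a else d1 X u a.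

Definition sum2 (f : bool -> R) : R := f false + f true.
Definition vsum2 (f : bool -> C2) : C2 := add2 (f false) (f true).

Definition normal_part (X : R -> R -> C2) (u a : R) (v : C2) : C2 :=
  sub2 v
    (vsum2 (fun i => vsum2 (fun j =>
       scal2 (RtoC (ginv X u a i j * fs_metric (X u a) v (tangent X u a i)))
         (tangent X u a j)))).

Definition second_partial (X : R -> R -> C2) (u a : R) (i j : bool) : C2 :=
  let T := fun u' a' => tangent X u' a' j in
  if i then d2 T u a else d1 T u a.

Definition second_fundamental_form (X : R -> R -> C2) (u a : R) (i j : bool) : C2 :=
  normal_part X u a
    (add2 (second_partial X u a i j)
       (fs_christoffel (X u a) (tangent X u a i) (tangent X u a j))).

Definition mean_curvature (X : R -> R -> C2) (u a : R) : C2 :=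
  vsum2 (fun i => vsum2 (fun j =>
    scal2 (RtoC (ginv X u a i j)) (second_fundamental_form X u a i j))).

Definition sqnorm_second_fundamental_form (X : R -> R -> C2) (u a : R) : R :=
  sum2 (fun i => sum2 (fun j => sum2 (fun k => sum2 (fun l =>
    ginv X u a i k * ginv X u a j l *
    fs_metric (X u a) (second_fundamental_form X u a i j)
      (second_fundamental_form X u a k l))))).

(** * Connectedness *)

Definition connected {T : UniformSpace} (A : T -> Prop) : Prop :=
  forall U V : T -> Prop, open U -> open V ->
    (forall x, A x -> U x \/ V x) ->
    (exists x, A x /\ U x) -> (exists x, A x /\ V x) ->
    exists x, A x /\ U x /\ V x.

Definition component_of {T : UniformSpace} (A : T -> Prop) (x y : T) : Prop :=
  exists S : T -> Prop, connected S /\ (forall z, S z -> A z) /\ S x /\ S y.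

Definition is_component {T : UniformSpace} (A S : T -> Prop) : Prop :=
  exists x, A x /\ forall y, S y <-> component_of A x y.

(** * Equivariant Lagrangians and their profile curves *)

Definition cis (b : R) : C := (cos b, sin b).

Definition lagrangian (gamma : C -> Prop) (p : C2) : Prop :=
  exists z a, gamma z /\ p = (z * cis a, z * cis (- a))%C.

(* Parametrization of L_c for a parametrized curve c; it is Lagrangian whatever
   the curve c. *)
Definition sweep (c : R -> C) (u a : R) : C2 := (c u * cis a, c u * cis (- a))%C.

Definition antipode (c : R -> C) : R -> C := fun u => (- c u)%C.

(* The profile is one closed curve, or a closed curve together with its
   antipode. *)
Inductive profile_kind := Single | AntipodalPair.

Definition branches (k : profile_kind) (c : R -> C) : list (R -> C) :=
  match k with
  | Single => c :: nil
  | AntipodalPair => c :: antipode c :: nil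
  end.

Definition trace (cs : list (R -> C)) (z : C) : Prop :=
  exists c, In c cs /\ exists u, z = c u.

(* Closed curves are 1-periodic maps on R. *)
Definition embedded_closed (c : R -> C) : Prop :=
  (forall u, c (u + 1) = c u) /\
  (forall u v, 0 <= u < 1 -> 0 <= v < 1 -> c u = c v -> u = v) /\
  (forall u, dC c u <> RtoC 0).

Definition encloses_origin (gamma : C -> Prop) : Prop :=
  ~ gamma (RtoC 0) /\
  exists M, forall z,
    component_of (T := C_UniformSpace) (fun w => ~ gamma w) (RtoC 0) z ->
    Cmod z < M.

Definition equivariant (gamma : C -> Prop) : Prop :=
  forall z, gamma z -> gamma (- z)%C /\ gamma (Cconj z).

Definition equivariant_torus_profile (k : profile_kind) (c : R -> C) : Prop :=
  embedded_closed c /\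
  (forall u, c u <> RtoC 0) /\
  equivariant (trace (branches k c)) /\
  match k with
  | Single => encloses_origin (trace (c :: nil))
  | AntipodalPair =>
      (forall u v, c u <> antipode c v) /\
      ~ encloses_origin (trace (c :: nil)) /\
      ~ encloses_origin (trace (antipode c :: nil))
  end.

(** * Monotonicity *)

(* A disc in CP^2 is given by homogeneous coordinates U : C -> C^3 \ {0} over
   the closed unit disc; as the disc is contractible, every map to CP^2 lifts. *)
Definition smooth_disc (U : R -> R -> C3) : Prop :=
  (exists eta, 0 < eta /\
     let D := fun x y => x * x + y * y < (1 + eta) * (1 + eta) in
     Csmooth_on D (fun x y => fst (fst (U x y))) /\
     Csmooth_on D (fun x y => snd (fst (U x y))) /\
     Csmooth_on D (fun x y => snd (U x y))) /\
  (forall x y, x * x + y * y <= 1 -> herm3 (U x y) (U x y) <> RtoC 0).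

Definition boundary (U : R -> R -> C3) (s : R) : C3 :=
  U (cos (2 * PI * s)) (sin (2 * PI * s)).

Definition cone_scal (w : C) (Z : C3) : C3 := (scal2 w (fst Z), w * snd Z)%C.

Definition boundary_on (gamma : C -> Prop) (U : R -> R -> C3) : Prop :=
  forall s, exists w p, w <> RtoC 0 /\ lagrangian gamma p /\
    boundary U s = cone_scal w (chart p).

Definition symplectic_area (U : R -> R -> C3) : R :=
  RInt (fun x =>
    RInt (fun y => fs_form (U x y) (dC3 (fun s => U s y) x) (dC3 (fun s => U x s) y))
      (- sqrt (1 - x * x)) (sqrt (1 - x * x)))
    (-1) 1.

(* The bundle u^* (Lambda^2_C T CP^2) is trivialized over the disc by
   v /\ w |-> det (U, v, w), with v, w lifted to C^3; the Maslov index is the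
   degree of the square of the phase of det on the tangent planes of L along
   the boundary.  A vector v at [U] = [p : 1], U = w (p, 1), lifts to w (v, 0). *)
Definition maslov_index (cs : list (R -> C)) (U : R -> R -> C3) (m : Z) : Prop :=
  exists theta : R -> R,
    (forall s, continuous theta s) /\
    (forall s c u a w, In c cs -> w <> RtoC 0 ->
       boundary U s = cone_scal w (chart (sweep c u a)) ->
       let d := det3 (boundary U s)
                  (cone_scal w (chart_tangent (d1 (sweep c) u a)))
                  (cone_scal w (chart_tangent (d2 (sweep c) u a))) in
       (d * d)%C = (RtoC (Cmod d * Cmod d) * cis (theta s))%C) /\
    theta 1 - theta 0 = 2 * PI * IZR m.

Definition monotone (cs : list (R -> C)) : Prop :=
  forall U m, smooth_disc U -> boundary_on (trace cs) U -> maslov_index cs U m ->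
    6 * symplectic_area U = PI * IZR m.

(** * The flow *)

(* Smoothness on [0, T) x R, a set with boundary, is smoothness of an extension
   to a neighbourhood.  For the antipodal branch the flow equation holds
   automatically, since sweep (antipode c) u a = sweep c u (a + PI). *)
Definition mean_curvature_flow (T : R) (c : R -> R -> C) : Prop :=
  (exists eta, 0 < eta /\ Csmooth_on (fun t _ => - eta < t < T) c) /\
  (forall t u a, 0 <= t < T ->
     normal_part (sweep (c t)) u a (dC2 (fun s => sweep (c s) u a) t)
     = mean_curvature (sweep (c t)) u a).

Definition monotone_equivariant_LMCF (T : R) (k : profile_kind) (c : R -> R -> C)
  : Prop :=
  mean_curvature_flow T c /\
  (forall t, 0 <= t < T ->
     equivariant_torus_profile k (c t) /\ monotone (branches k (c t))).

(* The second fundamental form is unbounded near the origin as t -> T. *)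
Definition singular_at_origin (T : R) (c : R -> R -> C) : Prop :=
  forall M r, 0 < r ->
    exists t u a, 0 <= t < T /\ T - r < t /\ Cmod (c t u) < r /\
      M < sqnorm_second_fundamental_form (sweep (c t)) u a.

(** * Cones *)

Definition line_param (b : R) (rho : R) : C := (RtoC rho * cis b)%C.

Definition line (b : R) (z : C) : Prop := exists rho, z = line_param b rho.

Definition cone (b a : R) (z : C) : Prop := line (b - a / 2) z \/ line (b + a / 2) z.

(** * Radon measures and type I blow-ups *)

(* Euclidean area element in C^2. *)
Definition area_density (X : R -> R -> C2) (u a : R) : R :=
  let g := fun v w => Re (herm2 v w) in
  let e := d1 X u a in
  let f := d2 X u a in
  sqrt (g e e * g f f - g e f * g e f).

(* As (-z, a) and (z, a + PI) give the same point of C^2, for a profile with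
   gamma = - gamma the angle only runs through [0, PI). *)
Definition fibre_integral (phi : C2 -> R) (c : R -> C) (u : R) : R :=
  RInt (fun a => phi (sweep c u a) * area_density (sweep c) u a) 0 PI.

Definition area_integral (cs : list (R -> C)) (phi : C2 -> R) : R :=
  fold_right Rplus 0 (map (fun c => RInt (fibre_integral phi c) 0 1) cs).

Definition line_area_integral (b : R) (phi : C2 -> R) : R :=
  RInt_gen (fibre_integral phi (line_param b))
    (Rbar_locally m_infty) (Rbar_locally p_infty).

Definition cone_area_integral (b a : R) (phi : C2 -> R) : R :=
  line_area_integral (b - a / 2) phi + line_area_integral (b + a / 2) phi.

Definition restrict (Sigma : C2 -> Prop) (phi : C2 -> R) (p : C2) : R :=
  if excluded_middle_informative (Sigma p) then phi p else 0.

(* Radii are measured in the profile plane, and (z e^{ia}, z e^{-ia}) has norm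
   sqrt 2 |z| in C^2. *)
Definition ball2 (r : R) (p : C2) : Prop := Re (herm2 p p) < 2 * (r * r).

Definition test_function (r : R) (phi : C2 -> R) : Prop :=
  (forall p, continuous phi p) /\
  exists r', 0 < r' < r /\ forall p, ~ ball2 r' p -> phi p = 0.

Definition rescaled (k : profile_kind) (c : R -> R -> C) (T lam s : R)
  : list (R -> C) :=
  branches k (fun u => Cmult (RtoC lam) (c (T + s / (lam * lam)) u)).

(* Along the sequence lam, the rescaled flows converge as Radon measures to the
   static cone C^b_a, with some positive integer multiplicity. *)
Definition type_I_blowup_is_cone (T : R) (k : profile_kind) (c : R -> R -> C)
    (lam : nat -> R) (b a : R) : Prop :=
  (forall j, 0 < lam j) /\
  is_lim_seq lam p_infty /\
  exists m : nat, (0 < m)%nat /\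
    forall s, s < 0 -> forall r phi, test_function r phi ->
      is_lim_seq (fun j => area_integral (rescaled k c T (lam j) s) phi)
        (INR m * cone_area_integral b a phi).

(* Only finitely many j are excluded by [eventually]: among them those for which
   T + s / lam_j^2 is negative. *)
Definition component_sequence (T : R) (k : profile_kind) (c : R -> R -> C)
    (lam : nat -> R) (s rho : R) (Sigma : nat -> C2 -> Prop) : Prop :=
  eventually (fun j =>
    is_component (T := prod_UniformSpace C_UniformSpace C_UniformSpace)
      (fun p => lagrangian (trace (rescaled k c T (lam j) s)) p /\ ball2 (4 * rho) p)
      (Sigma j) /\
    exists p, Sigma j p /\ ball2 rho p).

(* Convergence is only required in B_{2 rho}, well inside the ball B_{4 rho}
   defining the components. *)
Definition components_converge_to_cone (T : R) (k : profile_kind) (c : R -> R -> C)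
    (lam : nat -> R) (s rho : R) (Sigma : nat -> C2 -> Prop) (b a : R) : Prop :=
  exists m : nat, (0 < m)%nat /\
    forall phi, test_function (2 * rho) phi ->
      is_lim_seq
        (fun j => area_integral (rescaled k c T (lam j) s) (restrict (Sigma j) phi))
        (INR m * cone_area_integral b a phi).

(* The profile of a set Sigma invariant under the circle action consists of the
   z with (z, z) in Sigma. *)
Definition meets_real_axis (Sigma : C2 -> Prop) : Prop :=
  exists x : R, Sigma (RtoC x, RtoC x).

(* Main.v *)
(* Otherwise the profiles avoid, in a small ball and near time T, the sectors just
   outside the double sector |y| <= |x|, so the part inside this sector is relatively
   open and closed.  By positivity of the curvature of CP^2, minimal profiles that pass
   the real axis close to 0 leave the double sector at a small radius, whereas in C^2 the
   hyperbola x^2 - y^2 = k stays inside it.  A strict barrier of this kind, chosen inside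
   the ball that the profile misses at the start, can never be touched by the flow, by
   the maximum principle.  This keeps the points of the profile in the double sector
   away from 0, which contradicts the real points that tend to the singularity. *)
Require Import Defs.
From Stdlib Require Import Reals List ZArith Lra Lia Psatz Classical ClassicalEpsilon.
From Coquelicot Require Import Coquelicot.
Open Scope R_scope.

(** * Pairing extrinsic curvature terms with a normal vector *)

Lemma fs_metric_add (p v v' w : C2) :
  fs_metric p (add2 v v') w = fs_metric p v w + fs_metric p v' w.
Proof.
  unfold fs_metric.
  replace (fs_herm (chart p) (chart_tangent (add2 v v')) (chart_tangent w))
    with (fs_herm (chart p) (chart_tangent v) (chart_tangent w)
          + fs_herm (chart p) (chart_tangent v') (chart_tangent w))%C; [reflexivity|].
  unfold fs_herm, herm3, herm2, chart, chart_tangent, add2; simpl fst; simpl snd.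
  unfold Cdiv; ring.
Qed.

Lemma fs_metric_scal (p : C2) (a : R) (v w : C2) :
  fs_metric p (scal2 (RtoC a) v) w = a * fs_metric p v w.
Proof.
  unfold fs_metric.
  replace (fs_herm (chart p) (chart_tangent (scal2 (RtoC a) v)) (chart_tangent w))
    with (RtoC a * fs_herm (chart p) (chart_tangent v) (chart_tangent w))%C.
  - destruct (fs_herm (chart p) (chart_tangent v) (chart_tangent w)); simpl; ring.
  - unfold fs_herm, herm3, herm2, chart, chart_tangent, scal2; simpl fst; simpl snd.
    unfold Cdiv; ring.
Qed.

(** The tangential correction in [normal_part] is a real combination of tangent vectors, each of
    which pairs to zero with [w]. *)
Lemma fs_metric_normal_part (X : R -> R -> C2) (u a : R) (v w : C2) :
  (forall i, fs_metric (X u a) (tangent X u a i) w = 0) ->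
  fs_metric (X u a) (normal_part X u a v) w = fs_metric (X u a) v w.
Proof.
  intro h. unfold normal_part, sub2, vsum2.
  repeat rewrite ?fs_metric_add, ?fs_metric_scal, ?h. ring.
Qed.

(** A normal [w] does not see the projections, and [gF = 0] makes the inverse metric diagonal, so no
    mixed second partial survives. *)
Lemma fs_metric_mean_curvature (X : R -> R -> C2) (u a : R) (w : C2) :
  (forall i, fs_metric (X u a) (tangent X u a i) w = 0) ->
  gF X u a = 0 -> gE X u a <> 0 -> gG X u a <> 0 ->
  fs_metric (X u a) (mean_curvature X u a) w =
    (fs_metric (X u a) (second_partial X u a false false) w
     + fs_metric (X u a) (fs_christoffel (X u a) (Defs.d1 X u a) (Defs.d1 X u a)) w) / gE X u a
    + (fs_metric (X u a) (second_partial X u a true true) w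
     + fs_metric (X u a) (fs_christoffel (X u a) (Defs.d2 X u a) (Defs.d2 X u a)) w) / gG X u a.
Proof.
  intros h hF hE hG. unfold mean_curvature, vsum2, second_fundamental_form.
  repeat rewrite fs_metric_add. repeat rewrite fs_metric_scal.
  repeat rewrite fs_metric_normal_part by exact h.
  repeat rewrite fs_metric_add.
  unfold ginv, tangent. rewrite hF. field. split; assumption.
Qed.

(** * Derivatives of the swept surface *)

Lemma is_derive_lincomb (f g : R -> R) (u x y a b : R) :
  is_derive f u x -> is_derive g u y ->
  is_derive (fun s => f s * a + g s * b) u (x * a + y * b).
Proof.
  intros hx hy.
  auto_derive; [split; [now exists x|split; [now exists y|trivial]]|].
  replace (Derive (fun x0 : R => f x0) u) with x by (symmetry; now apply is_derive_unique).
  replace (Derive (fun x0 : R => g x0) u) with y by (symmetry; now apply is_derive_unique).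
  ring.
Qed.

Lemma dC_mult_const (f : R -> C) (w : C) (u x y : R) :
  is_derive (fun s => Re (f s)) u x -> is_derive (fun s => Im (f s)) u y ->
  dC (fun s => (f s * w)%C) u = ((x, y) * w)%C.
Proof.
  intros hx hy. destruct w as [w1 w2].
  apply injective_projections; apply is_derive_unique; simpl.
  - apply (is_derive_ext (fun s => Re (f s) * w1 + Im (f s) * - w2)).
    + intro s. unfold Re, Im. simpl. ring.
    + replace (x * w1 - y * w2) with (x * w1 + y * - w2) by ring.
      now apply is_derive_lincomb.
  - now apply (is_derive_lincomb (fun s => Re (f s)) (fun s => Im (f s))).
Qed.

Lemma dC_const_mult_cis (z : C) (a : R) :
  dC (fun s => (z * cis s)%C) a = (z * (Ci * cis a))%C.
Proof.
  destruct z as [x y]. unfold dC, cis, Ci.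
  apply injective_projections; simpl; apply is_derive_unique; auto_derive; trivial; ring.
Qed.

Lemma dC_const_mult_cis_opp (z : C) (a : R) :
  dC (fun s => (z * cis (- s))%C) a = (z * (- Ci * cis (- a)))%C.
Proof.
  destruct z as [x y]. unfold dC, cis, Ci.
  apply injective_projections; simpl; apply is_derive_unique; auto_derive; trivial; ring.
Qed.

Lemma dC_ext (f g : R -> C) (u : R) : (forall s, f s = g s) -> dC f u = dC g u.
Proof.
  intro h. unfold dC. f_equal; apply Derive_ext; intro s; rewrite h; reflexivity.
Qed.

Lemma d2_sweep (c : R -> C) (u a : R) :
  Defs.d2 (sweep c) u a = (c u * (Ci * cis a), c u * (- Ci * cis (- a)))%C.
Proof.
  unfold Defs.d2, dC2, sweep. cbn [fst snd].
  now rewrite dC_const_mult_cis, dC_const_mult_cis_opp.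
Qed.

Lemma d2_d2_sweep (c : R -> C) (u a : R) :
  second_partial (sweep c) u a true true = (- c u * cis a, - c u * cis (- a))%C.
Proof.
  unfold second_partial, tangent, Defs.d2 at 1, dC2.
  apply injective_projections; cbn [fst snd].
  - rewrite (dC_ext _ (fun s => (c u * Ci * cis s)%C)).
    + rewrite dC_const_mult_cis. generalize (c u) (cis a). intros [x y] [p q].
      apply injective_projections; simpl; ring.
    + intro s. rewrite d2_sweep. simpl. ring.
  - rewrite (dC_ext _ (fun s => (c u * - Ci * cis (- s))%C)).
    + rewrite dC_const_mult_cis_opp. generalize (c u) (cis (- a)). intros [x y] [p q].
      apply injective_projections; simpl; ring.
    + intro s. rewrite d2_sweep. simpl. ring.
Qed.

Lemma d1_sweep (c : R -> C) (u a x y : R) :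
  is_derive (fun s => Re (c s)) u x -> is_derive (fun s => Im (c s)) u y ->
  Defs.d1 (sweep c) u a = ((x, y) * cis a, (x, y) * cis (- a))%C.
Proof.
  intros hx hy. unfold Defs.d1, dC2, sweep. cbn [fst snd].
  now rewrite !(dC_mult_const c _ u x y hx hy).
Qed.

(** The first derivatives are required at every parameter, since the inner derivative has to be
    rewritten as a function before it is differentiated again. *)
Lemma d1_d1_sweep (c : R -> C) (u a : R) (x y : R -> R) (x' y' : R) :
  (forall v, is_derive (fun s => Re (c s)) v (x v)) ->
  (forall v, is_derive (fun s => Im (c s)) v (y v)) ->
  is_derive x u x' -> is_derive y u y' ->
  second_partial (sweep c) u a false false = ((x', y') * cis a, (x', y') * cis (- a))%C.
Proof.
  intros hx hy hx' hy'. unfold second_partial, tangent, Defs.d1 at 1, dC2.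
  apply injective_projections; cbn [fst snd].
  - rewrite (dC_ext _ (fun s => ((x s, y s) * cis a)%C)).
    + now apply (dC_mult_const (fun s => (x s, y s))).
    + intro s. now rewrite (d1_sweep c s a (x s) (y s)).
  - rewrite (dC_ext _ (fun s => ((x s, y s) * cis (- a))%C)).
    + now apply (dC_mult_const (fun s => (x s, y s))).
    + intro s. now rewrite (d1_sweep c s a (x s) (y s)).
Qed.

(** * The Fubini-Study data at angle 0 and the profile equation *)

Lemma cis_0 : cis 0 = RtoC 1.
Proof. unfold cis. now rewrite cos_0, sin_0. Qed.

(** At angle 0 the surface passes through [(z, z)], where [herm3 Z Z] is the real number
    [1 + 2 |z|^2], so the complex quotient becomes a real one. *)
Lemma fs_metric_diag (x y : R) (v w : C2) :
  fs_metric ((x, y), (x, y)) v w =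
    Re ((RtoC (1 + 2 * (x * x + y * y)) * herm2 v w
         - herm2 v ((x, y), (x, y)) * herm2 ((x, y), (x, y)) w)%C)
    / ((1 + 2 * (x * x + y * y)) * (1 + 2 * (x * x + y * y))).
Proof.
  set (D := 1 + 2 * (x * x + y * y)).
  assert (hD : 0 < D) by (unfold D; nra).
  unfold fs_metric, fs_herm.
  replace (herm3 (chart ((x, y), (x, y))) (chart ((x, y), (x, y)))) with (RtoC D).
  2:{ unfold D. apply injective_projections; simpl; ring. }
  replace (herm3 (chart_tangent v) (chart_tangent w)) with (herm2 v w)
    by (unfold herm3; simpl; ring).
  replace (herm3 (chart_tangent v) (chart ((x, y), (x, y))))
    with (herm2 v ((x, y), (x, y))) by (unfold herm3; simpl; ring).
  replace (herm3 (chart ((x, y), (x, y))) (chart_tangent w))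
    with (herm2 ((x, y), (x, y)) w)
    by (unfold herm3, chart, chart_tangent; cbn [fst snd];
        apply injective_projections; simpl; ring).
  unfold Cdiv. rewrite <- RtoC_mult, <- RtoC_inv by nra.
  unfold Re, RtoC. simpl. field. lra.
Qed.

Lemma fs_christoffel_diag (x y : R) (v w : C2) :
  fs_christoffel ((x, y), (x, y)) v w =
    scal2 (RtoC (- / (1 + 2 * (x * x + y * y))))
      (add2 (scal2 (herm2 v ((x, y), (x, y))) w) (scal2 (herm2 w ((x, y), (x, y))) v)).
Proof.
  unfold fs_christoffel. f_equal.
  rewrite RtoC_opp, RtoC_inv by nra. f_equal. f_equal.
  apply injective_projections; simpl; ring.
Qed.

Lemma fs_metric_diag_diag (x y a b e f : R) :
  fs_metric ((x, y), (x, y)) ((a, b), (a, b)) ((e, f), (e, f)) =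
    2 * (a * e + b * f) / ((1 + 2 * (x * x + y * y)) * (1 + 2 * (x * x + y * y))).
Proof. rewrite fs_metric_diag. simpl. field. nra. Qed.

(** With [z = x + i y] and [z' = p + i q], [v] is [- 4 conj(z) z'^2 / (1 + 2 |z|^2)] in real
    coordinates. *)
Lemma fs_christoffel_diag_diag (x y p q : R) :
  let k := - (4 / (1 + 2 * (x * x + y * y))) in
  let v := (k * ((x * p + y * q) * p - (x * q - y * p) * q),
            k * ((x * p + y * q) * q + (x * q - y * p) * p)) in
  fs_christoffel ((x, y), (x, y)) ((p, q), (p, q)) ((p, q), (p, q)) = (v, v).
Proof.
  intros k v. rewrite fs_christoffel_diag.
  unfold v, k. apply injective_projections; apply injective_projections; simpl; field; nra.
Qed.

(** An antidiagonal vector is Hermitian orthogonal to [(z, z)], so both coefficients in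
    [fs_christoffel] vanish. *)
Lemma fs_christoffel_diag_antidiag (x y p q : R) :
  fs_christoffel ((x, y), (x, y)) ((p, q), (- p, - q)) ((p, q), (- p, - q))
  = ((0, 0), (0, 0)).
Proof.
  rewrite fs_christoffel_diag.
  apply injective_projections; apply injective_projections; simpl; ring.
Qed.

(* The flow equation at angle 0 is paired with the normal [(i z', i z')], which is
   orthogonal to both tangent vectors and so removes all tangential terms. *)
Lemma profile_flow_equation (c : R -> R -> C) (t u : R) (xu yu : R -> R)
    (xt yt xuu yuu : R) :
  (forall v, is_derive (fun s => Re (c t s)) v (xu v)) ->
  (forall v, is_derive (fun s => Im (c t s)) v (yu v)) ->
  is_derive xu u xuu -> is_derive yu u yuu ->
  is_derive (fun s => Re (c s u)) t xt -> is_derive (fun s => Im (c s u)) t yt ->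
  let x := Re (c t u) in let y := Im (c t u) in
  0 < x * x + y * y -> 0 < xu u * xu u + yu u * yu u ->
  normal_part (sweep (c t)) u 0 (dC2 (fun s => sweep (c s) u 0) t)
    = mean_curvature (sweep (c t)) u 0 ->
  yt * xu u - xt * yu u =
    (1 + 2 * (x * x + y * y)) ^ 2 / 2 *
    ((yuu * xu u - xuu * yu u) / (xu u * xu u + yu u * yu u)
     + (x * yu u - y * xu u) * (1 - 4 * (x * x + y * y))
       / ((x * x + y * y) * (1 + 2 * (x * x + y * y)))).
Proof.
  intros hx hy hxx hyy hxt hyt x y hr hv H.
  set (w := ((- yu u, xu u), (- yu u, xu u)) : C2).
  apply (f_equal (fun V => fs_metric (sweep (c t) u 0) V w)) in H.
  assert (hX : sweep (c t) u 0 = ((x, y), (x, y))).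
  { unfold sweep. rewrite Ropp_0, cis_0, !Cmult_1_r.
    unfold x, y. now destruct (c t u). }
  assert (h1 := d1_sweep (c t) u 0 _ _ (hx u) (hy u)).
  assert (h2 := d2_sweep (c t) u 0).
  assert (h11 := d1_d1_sweep (c t) u 0 xu yu _ _ hx hy hxx hyy).
  assert (h22 := d2_d2_sweep (c t) u 0).
  assert (ht : dC2 (fun s => sweep (c s) u 0) t = ((xt, yt), (xt, yt))).
  { unfold dC2, sweep; cbn [fst snd].
    rewrite !(dC_mult_const (fun s => c s u) _ t xt yt hxt hyt).
    now rewrite Ropp_0, cis_0, !Cmult_1_r. }
  rewrite Ropp_0, cis_0, !Cmult_1_r in h1, h2, h11, h22.
  replace (c t u) with ((x, y) : C) in h2, h22 by (unfold x, y; now destruct (c t u)).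
  set (D := 1 + 2 * (x * x + y * y)).
  assert (hD : 0 < D) by (unfold D; nra).
  assert (hG : gG (sweep (c t)) u 0 = 2 * (x * x + y * y) / D).
  { unfold gG. rewrite hX, h2, fs_metric_diag. fold D. simpl. field. lra. }
  assert (hE : gE (sweep (c t)) u 0 = 2 * (xu u * xu u + yu u * yu u) / (D * D)).
  { unfold gE. rewrite hX, h1, fs_metric_diag. fold D. simpl.
    unfold D. field. fold D. lra. }
  assert (hF : gF (sweep (c t)) u 0 = 0).
  { unfold gF. rewrite hX, h1, h2, fs_metric_diag. fold D. simpl. field. lra. }
  assert (hw : forall i, fs_metric (sweep (c t) u 0) (tangent (sweep (c t)) u 0 i) w = 0).
  { intros [|]; unfold tangent, w; rewrite hX, ?h1, ?h2, fs_metric_diag; fold D; simpl;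
      field; lra. }
  rewrite (fs_metric_normal_part _ _ _ _ _ hw) in H.
  rewrite (fs_metric_mean_curvature _ _ _ _ hw hF) in H.
  2:{ rewrite hE. apply Rgt_not_eq, Rdiv_lt_0_compat; nra. }
  2:{ rewrite hG. apply Rgt_not_eq, Rdiv_lt_0_compat; nra. }
  rewrite hE, hG, h1, h2, h11, h22, ht, hX in H.
  (* [- - y] stays unsimplified to match the shape in [fs_christoffel_diag_antidiag]. *)
  replace (((x, y) * Ci)%C, ((x, y) * (- Ci * 1))%C)
    with (((- y, x), (- - y, - x)) : C2) in H
    by (apply injective_projections; apply injective_projections; simpl; ring).
  rewrite fs_christoffel_diag_diag in H.
  rewrite fs_christoffel_diag_antidiag in H.
  change (((- (x, y))%C, (- (x, y))%C) : C2) with (((- x, - y), (- x, - y)) : C2) in H.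
  unfold w in H. rewrite !fs_metric_diag_diag in H.
  fold D in H. set (p := xu u) in *. set (q := yu u) in *.
  clearbody x y p q.
  (* The left side is [D^2 / 2] times the metric pairing of the velocity with [w], for which [H] can
     be substituted. *)
  replace (yt * p - xt * q) with (D * D / 2 * (2 * (xt * - q + yt * p) / (D * D)))
    by (field; lra).
  rewrite H. unfold D. field. repeat split; nra.
Qed.

(** * The barrier and its differential inequality *)

(* For small [k] and [r], the minimal profile crossing the real axis at [sqrt k] has
   [x^2 - y^2 = k - 6 k r^2 log (r / sqrt k)] to leading order; replacing 6 by 1 makes
   it a strict barrier. *)
Definition barrier (k x y : R) : R :=
  x * x - y * y - k + k / 2 * (x * x + y * y) * ln ((x * x + y * y) / k).


(** If the logarithm were negative, then [x^2 + y^2 < k], so [x^2 - y^2 - k] and the logarithmic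
    term would both be negative. *)
Lemma barrier_zero_log_nonneg (k x y : R) :
  0 < k -> 0 < x * x + y * y -> barrier k x y = 0 ->
  0 <= ln ((x * x + y * y) / k).
Proof.
  unfold barrier. intros hk hr hB.
  destruct (Rle_or_lt 0 (ln ((x * x + y * y) / k))) as [|hL]; [easy|].
  assert (hq : 0 < (x * x + y * y) / k) by now apply Rdiv_lt_0_compat.
  assert (h1 : (x * x + y * y) / k < 1).
  { apply ln_lt_inv; [easy|lra|now rewrite ln_1]. }
  apply (Rmult_lt_compat_r k) in h1; [|easy].
  unfold Rdiv in h1. rewrite Rmult_assoc, Rinv_l, Rmult_1_l, Rmult_1_r in h1 by lra.
  set (L := ln ((x * x + y * y) / k)) in *.
  assert (0 < k * (x * x + y * y) * - L) by (repeat apply Rmult_lt_0_compat; lra).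
  nra.
Qed.

(** This is [1 + v <= exp v] at [v = 2 ln (r / k)], multiplied by [k^2]. *)
Lemma ln_sqr_le (r k : R) : 0 < k -> 0 < r ->
  k * k * (1 + 2 * ln (r / k)) <= r * r.
Proof.
  intros hk hr.
  assert (hq : 0 < r / k) by now apply Rdiv_lt_0_compat.
  assert (h := exp_ineq1_le (2 * ln (r / k))).
  replace (2 * ln (r / k)) with (ln (r / k) + ln (r / k)) in h at 2 by ring.
  rewrite exp_plus, exp_ln in h by easy.
  apply (Rmult_le_compat_l (k * k)) in h; [|nra].
  replace (k * k * (r / k * (r / k))) with (r * r) in h by (field; lra). exact h.
Qed.

(* The expression bounds from below, up to a positive factor, the speed of the
   barrier at a first touching point.  Here [(1 - 4 r2) / (r2 (1 + 2 r2))], which is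
   [1 / r2 - 6 / (1 + 2 r2)], is the radial derivative divided by the radius of
   [log (r / (1 + 2 r^2)^(3/2))], the logarithm of the conformal factor for which the
   geodesics are the profiles of minimal surfaces. *)
Lemma barrier_supersolution (k x y : R) :
  let r2 := x * x + y * y in
  let L := ln (r2 / k) in
  let Bx := x * (2 + k * (L + 1)) in
  let By := y * (k * (L + 1) - 2) in
  let Bxx := 2 + k * (L + 1) + 2 * k * (x * x) / r2 in
  let Bxy := 2 * k * (x * y) / r2 in
  let Byy := k * (L + 1) - 2 + 2 * k * (y * y) / r2 in
  let S := x * Bx + y * By in
  0 < k -> 0 < r2 -> r2 <= 1 / 20 -> y * y <= x * x -> barrier k x y = 0 ->
  0 < - (Bxx * (By * By) - 2 * Bxy * (Bx * By) + Byy * (Bx * Bx))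
      - (Bx * Bx + By * By) * S * (1 - 4 * r2) / (r2 * (1 + 2 * r2)).
Proof.
  intros r2 L Bx By Bxx Bxy Byy S hk hr hr' hxy hB.
  assert (hL : 0 <= L) by now apply (barrier_zero_log_nonneg k x y).
  assert (hL2 : k * k * (1 + 2 * L) <= r2 * r2) by now apply ln_sqr_le.
  assert (hq : x * x - y * y = k - k * r2 * L / 2)
    by (unfold barrier in hB; fold r2 in hB; fold L in hB; lra).
  clearbody L.
  (* On the zero set of the barrier the logarithmic terms of [S] cancel. *)
  assert (hS : S = k * (2 + r2)).
  { unfold S, Bx, By. transitivity (2 * (x * x - y * y) + k * (L + 1) * r2);
    [unfold r2; ring|rewrite hq; field]. }
  (* Splitting into radial and angular parts: [x * By - y * Bx = - 4 x y]. *)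
  assert (hG : Bx * Bx + By * By = (16 * (x * y) * (x * y) + S * S) / r2).
  { unfold S, Bx, By, r2. field. fold r2. lra. }
  (* The last term is split off because it cancels the [1 / r2] part of the weight. What remains of
     the weight is the favourable curvature contribution [6 / (1 + 2 * r2)]. *)
  assert (hH : Bxx * (By * By) - 2 * Bxy * (Bx * By) + Byy * (Bx * Bx) =
     k / r2 * (32 * (x * y) * (x * y) + 2 * (L + 1) * (S * S)) - (Bx * Bx + By * By) * S / r2).
  { rewrite hG. unfold S, Bxx, Bxy, Byy, Bx, By, r2. field. fold r2. lra. }
  rewrite hH, hG, hS. clear hH hG hS S Bx By Bxx Bxy Byy hB.
  set (P := (x * y) * (x * y)).
  assert (hP : 4 * P = r2 * r2 - (x * x - y * y) * (x * x - y * y)) by (unfold P, r2; ring).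
  replace (16 * (x * y) * (x * y)) with (16 * P) by (unfold P; ring).
  replace (32 * (x * y) * (x * y)) with (32 * P) by (unfold P; ring).
  assert (h0 : 0 <= k * r2 * L) by (repeat apply Rmult_le_pos; lra).
  (* On the zero set in the double sector, [0 <= x^2 - y^2 <= k]. With [hL2] this bounds [k^2 L] by
     [2 P], which controls the only unfavourable term containing [L]. *)
  assert (hq' : (x * x - y * y) * (x * x - y * y) <= k * k) by nra.
  assert (hP2 : 2 * (k * k * L) <= 4 * P) by lra.
  clearbody P r2. clear hP hq hq' hL2 h0 hxy x y.
  set (Q := k * k * ((2 + r2) * (2 + r2))).
  match goal with |- 0 < ?e => replace e with
    (k / r2 * (6 * (2 + r2) / (1 + 2 * r2) * (16 * P + Q) - (32 * P + 2 * (L + 1) * Q)))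
    by (unfold Q; field; lra) end.
  apply Rmult_lt_0_compat; [now apply Rdiv_lt_0_compat|].
  (* With 10 as coefficient there remains [128 P + 8 Q - 2 L Q], where [2 L Q <= 10 k^2 L <= 20 P]
     and [Q > 0]. *)
  assert (h10 : 10 <= 6 * (2 + r2) / (1 + 2 * r2)).
  { apply (Rmult_le_reg_r (1 + 2 * r2)); [lra|]. unfold Rdiv. rewrite Rmult_assoc, Rinv_l; lra. }
  assert (hQ0 : 4 * (k * k) <= Q) by (unfold Q; nra).
  assert (hQ1 : Q <= 5 * (k * k)) by (unfold Q; nra).
  assert (hkk : 0 < k * k) by nra.
  assert (hkL : 0 <= k * k * L) by nra.
  assert (L * Q <= 5 * (k * k * L)) by nra.
  assert (10 * (16 * P + Q) <= 6 * (2 + r2) / (1 + 2 * r2) * (16 * P + Q)).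
  { apply Rmult_le_compat_r; lra. }
  nra.
Qed.

(** Here [(p, q)], [(m, n)] and [(v, w)] are the first and second parameter derivatives and the
    velocity of the profile. By [h1] the gradient is [mu * (- q, p)]. By [h2] its product with
    [(m, n)] is at least minus the Hessian on the tangent. The flow equation then reduces the claim
    to [barrier_supersolution]. *)
Lemma barrier_time_derivative_pos (k x y p q m n v w : R) :
  let r2 := x * x + y * y in
  let L := ln (r2 / k) in
  let Bx := x * (2 + k * (L + 1)) in
  let By := y * (k * (L + 1) - 2) in
  let Bxx := 2 + k * (L + 1) + 2 * k * (x * x) / r2 in
  let Bxy := 2 * k * (x * y) / r2 in
  let Byy := k * (L + 1) - 2 + 2 * k * (y * y) / r2 in
  0 < k -> 0 < r2 -> r2 <= 1 / 20 -> y * y <= x * x -> barrier k x y = 0 ->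
  0 < p * p + q * q ->
  w * p - v * q =
    (1 + 2 * r2) ^ 2 / 2 *
    ((n * p - m * q) / (p * p + q * q)
     + (x * q - y * p) * (1 - 4 * r2) / (r2 * (1 + 2 * r2))) ->
  Bx * p + By * q = 0 ->
  0 <= Bxx * (p * p) + 2 * Bxy * (p * q) + Byy * (q * q) + Bx * m + By * n ->
  0 < Bx * v + By * w.
Proof.
  intros r2 L Bx By Bxx Bxy Byy hk hr hr' hxy hB hV hflow h1 h2.
  assert (hN := barrier_supersolution k x y hk hr hr' hxy hB). cbv zeta in hN.
  fold r2 in hN. fold L in hN. fold Bx in hN. fold By in hN.
  fold Bxx in hN. fold Bxy in hN. fold Byy in hN.
  set (V := p * p + q * q) in *.
  set (mu := (By * p - Bx * q) / V).
  assert (ex : Bx = - mu * q).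
  { unfold mu. apply (Rmult_eq_reg_r V); [|lra].
    transitivity (- (By * p - Bx * q) * q); [|field; lra]. unfold V.
    assert (p * (Bx * p + By * q) = 0) by (rewrite h1; ring). lra. }
  assert (ey : By = mu * p).
  { unfold mu. apply (Rmult_eq_reg_r V); [|lra].
    transitivity ((By * p - Bx * q) * p); [|field; lra]. unfold V.
    assert (q * (Bx * p + By * q) = 0) by (rewrite h1; ring). lra. }
  clearbody Bx By Bxx Bxy Byy mu. subst Bx By.
  set (c0 := (1 - 4 * r2) / (r2 * (1 + 2 * r2))).
  assert (hN' : 0 < mu * mu * V * (- (Bxx * (p * p) + 2 * Bxy * (p * q) + Byy * (q * q)) / V
                - (x * (- mu * q) + y * (mu * p)) * c0)).
  { eapply Rlt_le_trans; [exact hN|]. right. unfold c0, V. field. fold V.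
    repeat split; nra. }
  (* Since the product in [hN'] is strictly positive, the case [mu = 0] needs no separate
     treatment. *)
  assert (0 <= mu * mu * V) by (apply Rmult_le_pos; nra).
  assert (hN2 : 0 < - (Bxx * (p * p) + 2 * Bxy * (p * q) + Byy * (q * q)) / V
                - (x * (- mu * q) + y * (mu * p)) * c0) by nra.
  replace (- mu * q * v + mu * p * w) with (mu * (w * p - v * q)) by ring.
  rewrite hflow.
  replace (mu * ((1 + 2 * r2) ^ 2 / 2 *
    ((n * p - m * q) / V + (x * q - y * p) * (1 - 4 * r2) / (r2 * (1 + 2 * r2)))))
    with ((1 + 2 * r2) ^ 2 / 2 * (((- mu * q) * m + mu * p * n) / V
       - (x * (- mu * q) + y * (mu * p)) * c0))
    by (unfold c0; field; lra).
  apply Rmult_lt_0_compat; [nra|].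
  eapply Rlt_le_trans; [exact hN2|].
  apply Rplus_le_compat_r. apply Rmult_le_compat_r; [left; now apply Rinv_0_lt_compat|lra].
Qed.

(** Stated along an arbitrary plane curve, to serve both for the profile parameter and for time. *)
Lemma is_derive_barrier (k : R) (f g : R -> R) (u p q : R) :
  0 < k -> 0 < f u * f u + g u * g u -> is_derive f u p -> is_derive g u q ->
  let L := ln ((f u * f u + g u * g u) / k) in
  is_derive (fun s => barrier k (f s) (g s)) u
    (f u * (2 + k * (L + 1)) * p + g u * (k * (L + 1) - 2) * q).
Proof.
  intros hk hr hf hg L. unfold barrier.
  assert (0 < (f u * f u + g u * g u) / k) by now apply Rdiv_lt_0_compat.
  auto_derive.
  - repeat split; try (now exists p); try (now exists q); lra.
  - replace (Derive (fun x : R => f x) u) with p by (symmetry; now apply is_derive_unique).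
    replace (Derive (fun x : R => g x) u) with q by (symmetry; now apply is_derive_unique).
    unfold L, Rdiv. field. lra.
Qed.

Lemma is_derive_barrier_derivative (k : R) (f g f1 g1 : R -> R) (u m n : R) :
  0 < k -> 0 < f u * f u + g u * g u ->
  is_derive f u (f1 u) -> is_derive g u (g1 u) ->
  is_derive f1 u m -> is_derive g1 u n ->
  let p := f1 u in
  let q := g1 u in
  let r2 := f u * f u + g u * g u in
  let L v := ln ((f v * f v + g v * g v) / k) in
  is_derive (fun v => f v * (2 + k * (L v + 1)) * f1 v + g v * (k * (L v + 1) - 2) * g1 v) u
    ((2 + k * (L u + 1) + 2 * k * (f u * f u) / r2) * (p * p)
     + 2 * (2 * k * (f u * g u) / r2) * (p * q)
     + (k * (L u + 1) - 2 + 2 * k * (g u * g u) / r2) * (q * q)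
     + f u * (2 + k * (L u + 1)) * m + g u * (k * (L u + 1) - 2) * n).
Proof.
  intros hk hr hf hg hf1 hg1 p q r2 L. unfold L.
  assert (0 < (f u * f u + g u * g u) / k) by now apply Rdiv_lt_0_compat.
  auto_derive.
  - repeat split; try (now exists p); try (now exists q); try (now exists m);
      try (now exists n); lra.
  - replace (Derive (fun x : R => f x) u) with p by (symmetry; now apply is_derive_unique).
    replace (Derive (fun x : R => g x) u) with q by (symmetry; now apply is_derive_unique).
    replace (Derive (fun x : R => f1 x) u) with m by (symmetry; now apply is_derive_unique).
    replace (Derive (fun x : R => g1 x) u) with n by (symmetry; now apply is_derive_unique).
    fold p q. unfold r2, Rdiv. field. lra.
Qed.

(** * Derivative tests at a minimum *)

Lemma is_derive_pos_locally_increasing (h : R -> R) (u l : R) :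
  is_derive h u l -> 0 < l ->
  exists d, 0 < d /\ (forall v, u < v < u + d -> h u < h v)
    /\ (forall v, u - d < v < u -> h v < h u).
Proof.
  intros hd hl. apply is_derive_Reals in hd.
  destruct (hd l hl) as [d hh]. exists d. split; [apply cond_pos|].
  assert (key : forall e, e <> 0 -> Rabs e < d -> 0 < (h (u + e) - h u) / e).
  { intros e he hed. specialize (hh e he hed). apply Rabs_lt_between in hh. lra. }
  split; intros v hv; specialize (key (v - u)); replace (u + (v - u)) with v in key by ring.
  - assert (hp : 0 < (h v - h u) / (v - u)) by (apply key; [lra|rewrite Rabs_right; lra]).
    apply (Rmult_lt_compat_r (v - u)) in hp; [|lra].
    unfold Rdiv in hp. rewrite Rmult_assoc, Rinv_l in hp; lra.
  - assert (hp : 0 < (h v - h u) / (v - u)) by (apply key; [lra|rewrite Rabs_left; lra]).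
    apply (Rmult_lt_compat_r (u - v)) in hp; [|lra].
    replace ((h v - h u) / (v - u) * (u - v)) with (h u - h v) in hp by (field; lra). lra.
Qed.

Lemma is_derive_nonneg_of_min_right (h : R -> R) (u l d : R) :
  0 < d -> is_derive h u l -> (forall v, u < v < u + d -> h u <= h v) -> 0 <= l.
Proof.
  intros hd hl hmin. destruct (Rle_or_lt 0 l) as [|hneg]; [easy|].
  apply is_derive_opp in hl.
  destruct (is_derive_pos_locally_increasing _ _ _ hl) as [e [he [hr _]]];
    [unfold opp; simpl; lra|].
  specialize (hr (u + Rmin d e / 2)). specialize (hmin (u + Rmin d e / 2)).
  assert (0 < Rmin d e) by now apply Rmin_glb_lt.
  assert (Rmin d e <= d) by apply Rmin_l. assert (Rmin d e <= e) by apply Rmin_r.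
  unfold opp in hr; simpl in hr. lra.
Qed.

(** The one-sided form suits time, where the barrier is compared with earlier values only. *)
Lemma is_derive_nonpos_of_min_left (h : R -> R) (u l d : R) :
  0 < d -> is_derive h u l -> (forall v, u - d < v < u -> h u <= h v) -> l <= 0.
Proof.
  intros hd hl hmin. destruct (Rle_or_lt l 0) as [|hpos]; [easy|].
  destruct (is_derive_pos_locally_increasing _ _ _ hl hpos) as [e [he [_ hr]]].
  specialize (hr (u - Rmin d e / 2)). specialize (hmin (u - Rmin d e / 2)).
  assert (0 < Rmin d e) by now apply Rmin_glb_lt.
  assert (Rmin d e <= d) by apply Rmin_l. assert (Rmin d e <= e) by apply Rmin_r.
  lra.
Qed.

(** A negative [h2] would make [h1] negative just to the right of its zero [u], and the mean value
    theorem would give values of [h] below [h u]. *)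
Lemma local_min_derivatives (h h1 : R -> R) (u h2 d : R) :
  0 < d -> (forall v, Rabs (v - u) < d -> is_derive h v (h1 v)) -> is_derive h1 u h2 ->
  (forall v, Rabs (v - u) < d -> h u <= h v) -> h1 u = 0 /\ 0 <= h2.
Proof.
  intros hd hh hh1 hmin.
  assert (hu : is_derive h u (h1 u)) by (apply hh; rewrite Rminus_eq_0, Rabs_R0; easy).
  assert (h0 : h1 u = 0).
  { apply Rle_antisym.
    - apply (is_derive_nonpos_of_min_left h u (h1 u) d hd hu).
      intros v hv. apply hmin. rewrite Rabs_left; lra.
    - apply (is_derive_nonneg_of_min_right h u (h1 u) d hd hu).
      intros v hv. apply hmin. rewrite Rabs_right; lra. }
  split; [easy|].
  destruct (Rle_or_lt 0 h2) as [|hneg]; [easy|exfalso].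
  apply is_derive_opp in hh1.
  destruct (is_derive_pos_locally_increasing _ _ _ hh1) as [e [he [hr _]]];
    [unfold opp; simpl; lra|].
  set (v := u + Rmin d e / 2).
  assert (0 < Rmin d e) by now apply Rmin_glb_lt.
  assert (Rmin d e <= d) by apply Rmin_l. assert (Rmin d e <= e) by apply Rmin_r.
  destruct (MVT_cor2 h h1 u v) as [w [hw1 hw2]]; [unfold v; lra| |].
  { intros w hw. apply is_derive_Reals, hh. unfold v in hw. rewrite Rabs_right; lra. }
  assert (hw : opp (h1 u) < opp (h1 w)) by (apply hr; unfold v in hw2; lra).
  unfold opp in hw; simpl in hw.
  assert (h u <= h v) by (apply hmin; unfold v; rewrite Rabs_right; lra).
  assert (v - u > 0) by (unfold v; lra). nra.
Qed.

(** * Continuous induction in time *)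

(** Tube lemma: by compactness, every point of [[a, b]] is covered by one of the chosen
    neighbourhoods of radius at least a common [d]. *)
Lemma locally_2d_interval_uniform (P : R -> R -> Prop) (t a b : R) :
  (forall u, a <= u <= b -> locally_2d P t u) ->
  exists d, 0 < d /\ forall t' u, Rabs (t' - t) < d -> a <= u <= b -> P t' u.
Proof.
  intro hP.
  assert (hsel : forall u, exists d : posreal, a <= u <= b ->
    forall t' v, Rabs (t' - t) < d -> Rabs (v - u) < d -> P t' v).
  { intro u. destruct (classic (a <= u <= b)) as [hu|hu].
    - destruct (hP u hu) as [d h]. now exists d.
    (* A dummy radius outside [[a, b]] makes the selection total. *)
    - exists (mkposreal 1 Rlt_0_1). easy. }
  set (delta u := proj1_sig (constructive_indefinite_description _ (hsel u))).
  assert (hdelta : forall u, a <= u <= b ->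
    forall t' v, Rabs (t' - t) < delta u -> Rabs (v - u) < delta u -> P t' v)
    by (intro u; exact (proj2_sig (constructive_indefinite_description _ (hsel u)))).
  clearbody delta.
  destruct (compactness_value_1d a b delta) as [d hd]. exists d. split; [apply cond_pos|].
  intros t' u ht hu. apply NNPP. intro hnP. apply (hd u hu).
  intros [v [hv [huv hdv]]]. apply hnP. apply (hdelta v hv); lra.
Qed.

(** Let [tau] be the supremum of the times up to which [Q] holds for all [u]. Then [ha] or [hstep]
    gives [Q] at [tau], and openness, made uniform on the unit interval, passes beyond [tau] unless
    [tau = b]. Periodicity enters through [hper]. *)
Lemma continuous_induction (Q : R -> R -> Prop) (a b : R) :
  (forall t u, a <= t <= b -> exists v, 0 <= v <= 1 /\ (Q t v -> Q t u)) ->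
  (forall t u, a <= t <= b -> Q t u -> locally_2d Q t u) ->
  (forall u, Q a u) ->
  (forall t, a < t <= b -> (forall t' u, a <= t' < t -> Q t' u) -> forall u, Q t u) ->
  forall t u, a <= t <= b -> Q t u.
Proof.
  intros hper hopen ha hstep.
  intros t0 u0 ht0.
  set (E := fun t => a <= t <= b /\ forall t' u, a <= t' <= t -> Q t' u).
  assert (hEa : E a).
  { split; [lra|]. intros t' u ht'. now replace t' with a by lra. }
  destruct (completeness E) as [tau [hub hlub]].
  { exists b. intros t [ht _]. lra. }
  { now exists a. }
  assert (htau : a <= tau <= b).
  { split; [now apply hub|]. apply hlub. intros t [ht _]. lra. }
  assert (hlt : forall t' u, a <= t' < tau -> Q t' u).
  { intros t' u ht'. apply NNPP. intro hQ.
    assert (tau <= t'); [|lra]. apply hlub. intros t [ht hE].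
    destruct (Rle_or_lt t t') as [|hlt]; [easy|]. exfalso. apply hQ, hE. lra. }
  assert (heq : forall u, Q tau u).
  { destruct (Req_dec tau a) as [->|hne]; [exact ha|]. apply hstep; [lra|exact hlt]. }
  destruct (locally_2d_interval_uniform Q tau 0 1) as [d [hd hQ]].
  { intros u _. now apply hopen. }
  assert (hE : E (Rmin b (tau + d / 2))).
  { assert (Rmin b (tau + d / 2) <= b) by apply Rmin_l.
    assert (Rmin b (tau + d / 2) <= tau + d / 2) by apply Rmin_r.
    split; [split; [apply Rmin_glb; lra|easy]|].
    intros t' u ht'. destruct (Rlt_or_le t' tau) as [hl|hl]; [now apply hlt|].
    destruct (hper t' u) as [v [hv hvu]]; [lra|]. apply hvu, hQ; [|easy].
    rewrite Rabs_right; lra. }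
  assert (hle := hub _ hE).
  assert (b <= tau).
  { unfold Rmin in hle. destruct (Rle_dec b (tau + d / 2)); lra. }
  apply hE. unfold Rmin. destruct (Rle_dec b (tau + d / 2)); lra.
Qed.

(** * Continuity and signs of the barrier *)

Lemma locally_2d_pos (f : R -> R -> R) (x y : R) :
  continuity_2d_pt f x y -> 0 < f x y -> locally_2d (fun u v => 0 < f u v) x y.
Proof.
  intros hf h. destruct (hf (mkposreal _ h)) as [d hd]. exists d.
  intros u v hu hv. specialize (hd u v hu hv). simpl in hd.
  apply Rabs_lt_between in hd. lra.
Qed.

Lemma continuity_2d_pt_barrier (k : R) (f g : R -> R -> R) (t u : R) :
  0 < k -> 0 < f t u * f t u + g t u * g t u ->
  continuity_2d_pt f t u -> continuity_2d_pt g t u ->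
  continuity_2d_pt (fun s v => barrier k (f s v) (g s v)) t u.
Proof.
  intros hk hr hf hg. unfold barrier, Rdiv.
  assert (0 < (f t u * f t u + g t u * g t u) * / k)
    by (apply Rmult_lt_0_compat; [easy|now apply Rinv_0_lt_compat]).
  repeat first [ exact hf | exact hg | apply continuity_2d_pt_const
    | apply continuity_2d_pt_minus | apply continuity_2d_pt_plus
    | apply continuity_2d_pt_mult
    | apply (continuity_1d_2d_pt_comp ln
        (fun s v => (f s v * f s v + g s v * g s v) * / k)) ].
  apply derivable_continuous_pt. exists (/ ((f t u * f t u + g t u * g t u) * / k)).
  now apply derivable_pt_lim_ln.
Qed.

(** The constant [k = a * exp (- (4 / a))] is chosen so that [ln (r2 / k) >= 4 / a] for [r2 >= a].
    The logarithmic term is then at least [2 k] and outweighs [- k]. *)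
Lemma barrier_pos_far (a x y : R) :
  0 < a -> y * y <= x * x -> a <= x * x + y * y ->
  0 < barrier (a * exp (- (4 / a))) x y.
Proof.
  intros ha hxy hr. unfold barrier. set (r2 := x * x + y * y) in *.
  set (k := a * exp (- (4 / a))).
  assert (hk : 0 < k) by (apply Rmult_lt_0_compat; [easy|apply exp_pos]).
  assert (hL : 4 / a <= ln (r2 / k)).
  { replace (4 / a) with (ln (a / k)).
    - apply ln_le; [now apply Rdiv_lt_0_compat|].
      apply Rmult_le_compat_r; [left; now apply Rinv_0_lt_compat|easy].
    - unfold k. replace (a / (a * exp (- (4 / a)))) with (exp (4 / a)).
      + apply ln_exp.
      + rewrite exp_Ropp. field. split; [apply Rgt_not_eq, exp_pos|lra]. }
  assert (4 <= r2 * ln (r2 / k)).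
  { replace 4 with (a * (4 / a)) by (field; lra).
    apply Rmult_le_compat; try lra. left. apply Rdiv_lt_0_compat; lra. }
  clearbody r2 k. nra.
Qed.

Lemma barrier_neg_axis (k x : R) : 0 < x * x < k -> barrier k x 0 < 0.
Proof.
  intros hx. unfold barrier.
  replace (x * x + 0 * 0) with (x * x) by ring.
  assert (hL : ln (x * x / k) < 0).
  { rewrite <- ln_1. apply ln_increasing; [apply Rdiv_lt_0_compat; lra|].
    apply (Rmult_lt_reg_r k); [lra|]. replace (x * x / k * k) with (x * x) by (field; lra). lra. }
  assert (0 < k * (x * x) * - ln (x * x / k))
    by (apply Rmult_lt_0_compat; [apply Rmult_lt_0_compat|]; lra).
  lra.
Qed.

Lemma cone_of_slope (e x y : R) :
  0 < e < PI / 4 ->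
  x * x < y * y -> y * y < tan (PI / 4 + e) * tan (PI / 4 + e) * (x * x) ->
  exists eps, 0 < eps < e /\ cone 0 (PI / 2 + 2 * eps) (x, y).
Proof.
  intros he h1 h2. set (K := tan (PI / 4 + e)) in *.
  assert (hPI := PI_RGT_0).
  assert (hK : 0 < K) by (apply tan_gt_0; lra).
  assert (hx : x <> 0) by (intros ->; nra).
  assert (hxx : 0 < x * x) by nra.
  set (m := y / x).
  assert (hy : y = m * x) by (unfold m; field; easy).
  assert (hm1 : 1 < m * m) by (rewrite hy in h1; nra).
  assert (hm2 : m * m < K * K) by (rewrite hy in h2; nra).
  assert (hz : forall b, atan m = b -> line b (x, y)).
  { intros b hb. exists (x / cos (atan m)). unfold line_param, cis. subst b.
    assert (hc : 0 < cos (atan m)).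
    { destruct (atan_bound m). apply cos_gt_0; lra. }
    assert (hs : sin (atan m) = m * cos (atan m)).
    { rewrite <- (tan_atan m) at 2. unfold tan. field. lra. }
    apply injective_projections; simpl; rewrite ?hs, ?hy; field; lra. }
  assert (hab : atan K = PI / 4 + e) by (apply atan_tan; lra).
  clearbody m K.
  destruct (Rlt_or_le 0 m) as [hpos|hneg].
  - assert (PI / 4 < atan m) by (rewrite <- atan_1; apply atan_increasing; nra).
    assert (atan m < PI / 4 + e) by (rewrite <- hab; apply atan_increasing; nra).
    exists (atan m - PI / 4). split; [lra|]. right. apply hz. field.
  - assert (atan m < - (PI / 4)).
    { rewrite <- atan_1, <- atan_opp. apply atan_increasing. nra. }
    assert (- (PI / 4 + e) < atan m).
    { rewrite <- hab, <- atan_opp. apply atan_increasing. nra. }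
    exists (- atan m - PI / 4). split; [lra|]. left. apply hz. field.
Qed.

Lemma smooth_on_partials (D : R -> R -> Prop) (f : R -> R -> R) :
  smooth_on D f ->
  exists ft fu fuu : R -> R -> R, forall t u, D t u ->
    continuity_2d_pt f t u /\ is_derive (fun s => f s u) t (ft t u) /\
    is_derive (f t) u (fu t u) /\ is_derive (fu t) u (fuu t u).
Proof.
  intro h.
  destruct (h 2%nat) as [hc [ft [fu [hd [_ [_ [ftu [fuu [hd2 _]]]]]]]]].
  exists ft, fu, fuu. intros t u hD.
  destruct (hd t u hD), (hd2 t u hD). auto.
Qed.

Lemma periodic_value_in_unit (A : Type) (f : R -> A) (u : R) :
  (forall v, f (v + 1) = f v) -> exists v, 0 <= v <= 1 /\ f v = f u.
Proof.
  intro hper.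
  assert (hnat : forall n v, f (v + INR n) = f v).
  { induction n as [|n IH]; intro v; [now rewrite Rplus_0_r|].
    rewrite S_INR, <- Rplus_assoc, hper. apply IH. }
  assert (hZ : forall z v, f (v + IZR z) = f v).
  { intros z v. destruct (Z_le_gt_dec 0 z) as [hz|hz].
    - rewrite <- (Z2Nat.id z hz), <- INR_IZR_INZ. apply hnat.
    - rewrite <- (hnat (Z.to_nat (- z)) (v + IZR z)).
      rewrite INR_IZR_INZ, Z2Nat.id, opp_IZR by lia. f_equal. ring. }
  exists (frac_part u). destruct (base_fp u) as [h0 h1]. split; [lra|].
  rewrite <- (hZ (Int_part u)). f_equal. unfold frac_part. ring.
Qed.

(** * The maximum principle *)

(** At a first failure the barrier vanishes at a point of the double sector. The gap keeps nearby
    points at earlier times in the sector, so this is a spatial minimum with nonpositive time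
    derivative, against [barrier_time_derivative_pos]. *)
Lemma barrier_avoidance (T : R) (kd : profile_kind) (c : R -> R -> C) (t0 t1 K rho a : R) :
  monotone_equivariant_LMCF T kd c ->
  0 <= t0 -> t1 < T -> 1 < K -> rho <= 1 / 20 -> 0 < a <= rho ->
  let x t u := Re (c t u) in
  let y t u := Im (c t u) in
  (forall t u, t0 <= t < T -> x t u * x t u + y t u * y t u < rho ->
     y t u * y t u < K * K * (x t u * x t u) -> y t u * y t u <= x t u * x t u) ->
  (forall u, a <= x t0 u * x t0 u + y t0 u * y t0 u) ->
  forall t u, t0 <= t <= t1 ->
    y t u * y t u <= x t u * x t u -> 0 < barrier (a * exp (- (4 / a))) (x t u) (y t u).
Proof.
  intros [[[eta [heta [hsx hsy]]] hmcf] hprof] ht0 ht1 hK hrho ha x y hgap hinit.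
  set (k := a * exp (- (4 / a))).
  assert (hk : 0 < k) by (apply Rmult_lt_0_compat; [easy|apply exp_pos]).
  assert (hr : forall t u, t0 <= t < T -> 0 < x t u * x t u + y t u * y t u).
  { intros t u ht. destruct (hprof t) as [[_ [hne _]] _]; [lra|]. specialize (hne u).
    unfold x, y. destruct (c t u) as [p q]; simpl.
    destruct (Req_dec p 0) as [->|hp]; [|nra].
    destruct (Req_dec q 0) as [->|hq]; [now contradict hne|nra]. }
  destruct (smooth_on_partials _ _ hsx) as [xt [xu [xuu hx]]].
  destruct (smooth_on_partials _ _ hsy) as [yt [yu [yuu hy]]].
  set (b t u := barrier k (x t u) (y t u)).
  assert (hbc : forall t u, t0 <= t < T -> continuity_2d_pt b t u).
  { intros t u ht. apply continuity_2d_pt_barrier; [easy|now apply hr|apply hx|apply hy]; lra. }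
  (* As a disjunction of strict inequalities the property is open, as continuous induction
     requires. *)
  enough (hQ : forall t u, t0 <= t <= t1 -> x t u * x t u < y t u * y t u \/ 0 < b t u).
  { intros t u ht hyx. destruct (hQ t u ht); [lra|easy]. }
  apply continuous_induction.
  - intros t u ht. destruct (hprof t) as [[[hper _] _] _]; [lra|].
    destruct (periodic_value_in_unit C (c t) u hper) as [v [hv hvu]].
    exists v. split; [easy|]. unfold b, x, y. now rewrite hvu.
  - intros t u ht [hyx|hb].
    + eapply locally_2d_impl; [|apply (locally_2d_pos (fun t u => y t u * y t u - x t u * x t u))].
      * apply locally_2d_forall. intros; left; lra.
      * apply continuity_2d_pt_minus; apply continuity_2d_pt_mult; (apply hx || apply hy); lra.
      * lra.
    + eapply locally_2d_impl; [|apply (locally_2d_pos b); [apply hbc; lra|easy]].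
      apply locally_2d_forall. intros; now right.
  - intro u. destruct (Rlt_or_le (x t0 u * x t0 u) (y t0 u * y t0 u)); [now left|right].
    now apply barrier_pos_far.
  - intros t ht hprev u.
    destruct (Rlt_or_le (x t u * x t u) (y t u * y t u)) as [|hyx]; [now left|right].
    apply Rnot_le_lt. intro hb.
    (* Failure occurs only within [a <= rho <= 1 / 20], where both the gap and the supersolution
       inequality are available. *)
    assert (hra : x t u * x t u + y t u * y t u < a).
    { apply Rnot_le_lt. intro h.
      assert (0 < b t u) by (apply barrier_pos_far; easy). lra. }
    assert (hr0 := hr t u ltac:(lra)).
    (* The gap makes the closed double sector relatively open in the profile near (t, u). *)
    assert (hloc : exists d, 0 < d /\ t0 < t - d /\ forall t' v,
      Rabs (t' - t) < d -> Rabs (v - u) < d -> t' <= t -> y t' v * y t' v <= x t' v * x t' v).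
    { destruct (locally_2d_pos (fun t u => rho - (x t u * x t u + y t u * y t u)) t u) as [d1 hd1].
      { apply continuity_2d_pt_minus; [apply continuity_2d_pt_const|].
        apply continuity_2d_pt_plus; apply continuity_2d_pt_mult; (apply hx || apply hy); lra. }
      { lra. }
      destruct (locally_2d_pos (fun t u => K * K * (x t u * x t u) - y t u * y t u) t u) as [d2 hd2].
      { apply continuity_2d_pt_minus; [apply continuity_2d_pt_mult; [apply continuity_2d_pt_const|]|];
         apply continuity_2d_pt_mult; (apply hx || apply hy); lra. }
      { assert (0 < x t u * x t u) by lra. assert (1 < K * K) by nra. nra. }
      exists (Rmin (Rmin d1 d2) ((t - t0) / 2)).
      assert (0 < Rmin d1 d2) by (apply Rmin_glb_lt; apply cond_pos).
      assert (Rmin d1 d2 <= d1) by apply Rmin_l.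
      assert (Rmin d1 d2 <= d2) by apply Rmin_r.
      assert (Rmin (Rmin d1 d2) ((t - t0) / 2) <= Rmin d1 d2) by apply Rmin_l.
      assert (Rmin (Rmin d1 d2) ((t - t0) / 2) <= (t - t0) / 2) by apply Rmin_r.
      split; [apply Rmin_glb_lt; lra|]. split; [lra|].
      intros t' v ht' hv htt. apply hgap.
      - apply Rabs_lt_between in ht'. lra.
      - apply Rlt_0_minus. apply (hd1 t' v); lra.
      - apply Rlt_0_minus. apply (hd2 t' v); lra. }
    destruct hloc as [d [hd [htd hloc]]].
    assert (hpos : forall t' v, t - d < t' < t -> Rabs (v - u) < d -> 0 < b t' v).
    { intros t' v ht' hv. destruct (hprev t' v) as [h|h]; [lra| |easy].
      assert (y t' v * y t' v <= x t' v * x t' v); [|lra].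
      apply hloc; [rewrite Rabs_left; lra|easy|lra]. }
    (* Positivity at earlier times passes to the limit as a weak inequality. *)
    assert (hnn : forall v, Rabs (v - u) < d -> 0 <= b t v).
    { intros v hv. apply Rnot_lt_le. intro hneg.
      destruct (locally_2d_pos (fun t u => - b t u) t v) as [e he].
      { apply continuity_2d_pt_opp, hbc. lra. }
      { lra. }
      assert (0 < Rmin d e) by (apply Rmin_glb_lt; [easy|apply cond_pos]).
      assert (Rmin d e <= d) by apply Rmin_l. assert (Rmin d e <= e) by apply Rmin_r.
      assert (h1 := hpos (t - Rmin d e / 2) v ltac:(lra) hv).
      assert (h2 : 0 < - b (t - Rmin d e / 2) v).
      { apply he; [rewrite Rabs_left; lra|rewrite Rminus_eq_0, Rabs_R0; lra]. }
      lra. }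
    assert (hb0 : b t u = 0).
    { apply Rle_antisym; [easy|]. apply hnn. rewrite Rminus_eq_0, Rabs_R0. easy. }
    assert (hxt := proj2 (hx t u ltac:(lra))). assert (hyt := proj2 (hy t u ltac:(lra))).
    destruct hxt as [hxt _]. destruct hyt as [hyt _].
    assert (hxu : forall v, is_derive (x t) v (xu t v)) by (intro; apply hx; lra).
    assert (hyu : forall v, is_derive (y t) v (yu t v)) by (intro; apply hy; lra).
    assert (hxuu : is_derive (xu t) u (xuu t u)) by (apply hx; lra).
    assert (hyuu : is_derive (yu t) u (yuu t u)) by (apply hy; lra).
    assert (hV : 0 < xu t u * xu t u + yu t u * yu t u).
    { destruct (hprof t) as [[[_ [_ himm]] _] _]; [lra|]. specialize (himm u).
      unfold dC in himm.
      change (Derive (fun s => Re (c t s)) u) with (Derive (x t) u) in himm.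
      change (Derive (fun s => Im (c t s)) u) with (Derive (y t) u) in himm.
      rewrite (is_derive_unique _ _ _ (hxu u)), (is_derive_unique _ _ _ (hyu u)) in himm.
      destruct (Req_dec (xu t u) 0) as [e1|hp]; [|nra].
      destruct (Req_dec (yu t u) 0) as [e2|hq]; [|nra].
      contradict himm. now rewrite e1, e2. }
    assert (hflow := profile_flow_equation c t u (xu t) (yu t) _ _ _ _ hxu hyu hxuu hyuu
      hxt hyt hr0 hV (hmcf t u 0 ltac:(lra))).
    destruct (local_min_derivatives (b t) _ u _ d hd
      (fun v _ => is_derive_barrier k (x t) (y t) v _ _ hk (hr t v ltac:(lra)) (hxu v) (hyu v))
      (is_derive_barrier_derivative k (x t) (y t) (xu t) (yu t) u _ _ hk hr0
         (hxu u) (hyu u) hxuu hyuu)) as [h1 h2].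
    { intros v hv. rewrite hb0. now apply hnn. }
    assert (hbt := is_derive_barrier k (fun s => x s u) (fun s => y s u) t _ _ hk hr0 hxt hyt).
    apply (is_derive_nonpos_of_min_left _ _ _ d hd) in hbt.
    2:{ intros t' ht'. change (b t u <= b t' u). rewrite hb0. left. apply hpos; [easy|].
        rewrite Rminus_eq_0, Rabs_R0. easy. }
    apply Rle_not_lt in hbt. apply hbt.
    apply (barrier_time_derivative_pos k (x t u) (y t u) (xu t u) (yu t u)
      (xuu t u) (yuu t u)); try easy; lra.
Qed.

(** * Real points of the rescaled components *)

(** Comparing the two coordinates leaves [p cos a = x] and kills the other products. Only the square
    of [Re z] is determined, as the angle [PI] flips the sign. *)
Lemma lagrangian_real_point (gamma : C -> Prop) (x : R) :
  lagrangian gamma (RtoC x, RtoC x) ->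
  exists z, gamma z /\ Im z = 0 /\ Re z * Re z = x * x.
Proof.
  intros [[p q] [a [hz h]]]. exists (p, q). split; [easy|].
  unfold cis in h. rewrite cos_neg, sin_neg in h. injection h as h1 h2 h3 h4.
  assert (hcs := sin2_cos2 a). unfold Rsqr in hcs.
  set (co := cos a) in *. set (si := sin a) in *. simpl.
  assert (e1 : q * si = 0) by lra. assert (e2 : q * co = 0) by lra.
  assert (e3 : p * si = 0) by lra. assert (e4 : p * co = x) by lra.
  split.
  - replace q with (q * si * si + q * co * co)
      by (transitivity (q * (si * si + co * co)); [ring|rewrite hcs; ring]).
    rewrite e1, e2. ring.
  - replace (p * p) with (p * si * (p * si) + p * co * (p * co))
      by (transitivity (p * p * (si * si + co * co)); [ring|rewrite hcs; ring]).
    rewrite e3, e4. ring.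
Qed.

Lemma trace_rescaled (k : profile_kind) (c : R -> R -> C) (T lam s : R) (z : C) :
  trace (rescaled k c T lam s) z ->
  exists u, let w := c (T + s / (lam * lam)) u in
    z = (RtoC lam * w)%C \/ z = (- (RtoC lam * w))%C.
Proof.
  unfold rescaled. intros [f [hf [u ->]]]. exists u.
  destruct k; simpl in hf.
  - destruct hf as [<-|[]]. now left.
  - destruct hf as [<-|[<-|[]]]; [now left|now right].
Qed.

(** A real point of [Sigma j] has [x^2 < 16 rho^2]; scaling back divides this by [lam j ^ 2], while
    the time [T + s / lam j ^ 2] tends to [T] from below. *)
Lemma real_points_near_origin (T : R) (k : profile_kind) (c : R -> R -> C)
    (lam : nat -> R) (s rho : R) (Sigma : nat -> C2 -> Prop) (t0 e : R) :
  is_lim_seq lam p_infty -> s < 0 -> t0 < T -> 0 < e ->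
  component_sequence T k c lam s rho Sigma ->
  eventually (fun j => meets_real_axis (Sigma j)) ->
  exists t u, t0 < t < T /\ Im (c t u) = 0 /\ Re (c t u) * Re (c t u) < e.
Proof.
  intros hlam hs ht0 he hcomp hreal.
  assert (hA : 0 < - s / (T - t0)) by (apply Rdiv_lt_0_compat; lra).
  assert (hB : 0 <= 16 * (rho * rho) / e) by (apply Rle_div_r; nra).
  apply is_lim_seq_spec in hlam.
  (* The summand 1 gives [lam j > 1], so that [lam j ^ 2] exceeds the threshold too. *)
  specialize (hlam (1 + - s / (T - t0) + 16 * (rho * rho) / e)).
  destruct hlam as [N1 h1], hcomp as [N2 h2], hreal as [N3 h3].
  set (j := (N1 + N2 + N3)%nat).
  specialize (h1 j ltac:(unfold j; lia)). destruct (h2 j ltac:(unfold j; lia)) as [hS _].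
  destruct (h3 j ltac:(unfold j; lia)) as [x hx].
  destruct hS as [x0 [_ hS]]. apply hS in hx. destruct hx as [A [_ [hA' [_ hx]]]].
  destruct (hA' _ hx) as [hlag hball].
  set (l := lam j) in *.
  assert (hl : 1 + - s / (T - t0) + 16 * (rho * rho) / e < l * l) by nra.
  destruct (lagrangian_real_point _ _ hlag) as [z [hz [hz1 hz2]]].
  destruct (trace_rescaled _ _ _ _ _ _ hz) as [u hu].
  exists (T + s / (l * l)), u. cbv zeta in hu.
  destruct (c (T + s / (l * l)) u) as [p q]; simpl.
  assert (hp : l * p * (l * p) = x * x /\ l * q = 0).
  { destruct hu as [-> | ->]; simpl in hz1, hz2; split; lra. }
  destruct hp as [hp hq].
  unfold ball2, herm2 in hball. simpl in hball.
  split; [split|split].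
  - apply (Rplus_lt_reg_l (- T)).
    replace (- T + (T + s / (l * l))) with (- (- s / (l * l))) by (field; nra).
    assert (- s / (l * l) < T - t0); [|lra].
    apply Rlt_div_l; [nra|].
    apply (Rmult_lt_reg_r (/ (T - t0))); [apply Rinv_0_lt_compat; lra|].
    replace ((T - t0) * (l * l) * / (T - t0)) with (l * l) by (field; lra).
    unfold Rdiv in *; lra.
  - assert (0 < - s / (l * l)) by (apply Rdiv_lt_0_compat; nra).
    replace (s / (l * l)) with (- (- s / (l * l))) by (field; nra). lra.
  - apply Rmult_integral in hq. destruct hq; [nra|easy].
  - apply (Rmult_lt_reg_l (l * l)); [nra|].
    assert (16 * (rho * rho) < l * l * e); [|nra].
    apply (Rmult_lt_reg_r (/ e)); [now apply Rinv_0_lt_compat|].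
    replace (l * l * e * / e) with (l * l) by (field; lra).
    unfold Rdiv in *; lra.
Qed.

(** * Initial distance and conclusion *)

Lemma profile_min_distance (c : R -> C) :
  (forall u, c (u + 1) = c u) -> (forall u, c u <> RtoC 0) ->
  (forall u, continuity_pt (fun v => Re (c v)) u) ->
  (forall u, continuity_pt (fun v => Im (c v)) u) ->
  exists a, 0 < a /\ forall u, a <= Re (c u) * Re (c u) + Im (c u) * Im (c u).
Proof.
  intros hper hne hx hy.
  destruct (continuity_ab_min (fun u => Re (c u) * Re (c u) + Im (c u) * Im (c u)) 0 1)
    as [m [hm _]]; [lra| |].
  { intros u _. apply continuity_pt_plus; apply continuity_pt_mult; easy. }
  exists (Re (c m) * Re (c m) + Im (c m) * Im (c m)). split.
  - specialize (hne m). destruct (c m) as [p q]; simpl.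
    destruct (Req_dec p 0) as [->|hp]; [|nra].
    destruct (Req_dec q 0) as [->|hq]; [now contradict hne|nra].
  - intro u. destruct (periodic_value_in_unit C c u hper) as [v [hv <-]]. now apply hm.
Qed.

Theorem lemma5p4 (T : R) (k : profile_kind) (c : R -> R -> C)
    (lam : nat -> R) (s rho : R) (Sigma : nat -> C2 -> Prop)
    (hT : 0 < T)
    (hflow : monotone_equivariant_LMCF T k c)
    (hsing : singular_at_origin T c)
    (hblowup : type_I_blowup_is_cone T k c lam 0 (PI / 2))
    (hs : s < 0) (hrho : 0 < rho)
    (hcomp : component_sequence T k c lam s rho Sigma)
    (hconv : components_converge_to_cone T k c lam s rho Sigma 0 (PI / 2))
    (hreal : eventually (fun j => meets_real_axis (Sigma j))) :
  forall R0 eps0 delta : R, 0 < R0 -> 0 < eps0 -> 0 < delta ->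
    exists eps t' : R,
      0 < eps < eps0 /\ PI / 2 + 2 * eps < PI /\
      T - delta < t' < T /\ 0 <= t' /\
      exists z : C,
        trace (branches k (c t')) z /\ Cmod z < R0 /\ cone 0 (PI / 2 + 2 * eps) z.
Proof.
  intros R0 eps0 delta hR0 heps0 hdelta. apply NNPP. intro hno.
  assert (hPI := PI_RGT_0).
  (* The bound [PI / 8] keeps [PI / 4 + e] below [PI / 2], where [tan] increases, and the opening
     below [PI]. *)
  set (e := Rmin eps0 (PI / 8)).
  assert (he : 0 < e) by (apply Rmin_glb_lt; lra).
  assert (he1 : e <= eps0) by apply Rmin_l. assert (he2 : e <= PI / 8) by apply Rmin_r.
  set (K := tan (PI / 4 + e)).
  assert (hK : 1 < K) by (rewrite <- tan_PI4; apply tan_increasing; lra).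
  set (t0 := (Rmax 0 (T - delta) + T) / 2).
  assert (Rmax 0 (T - delta) < T) by (apply Rmax_lub_lt; lra).
  assert (0 <= Rmax 0 (T - delta)) by apply Rmax_l.
  assert (T - delta <= Rmax 0 (T - delta)) by apply Rmax_r.
  assert (ht0 : 0 < t0 < T) by (unfold t0; lra).
  assert (ht0' : T - delta < t0) by (unfold t0; lra).
  (* Squared radius: inside [B_R] and in the range of the supersolution inequality. *)
  set (r := Rmin (R0 * R0) (1 / 20)).
  assert (hr : 0 < r) by (apply Rmin_glb_lt; nra).
  assert (hr1 : r <= R0 * R0) by apply Rmin_l. assert (hr2 : r <= 1 / 20) by apply Rmin_r.
  (* A point between the slopes 1 and [K] in absolute value would lie on a cone that [hno]
     forbids. *)
  assert (hgap : forall t u, t0 <= t < T ->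
    Re (c t u) * Re (c t u) + Im (c t u) * Im (c t u) < r ->
    Im (c t u) * Im (c t u) < K * K * (Re (c t u) * Re (c t u)) ->
    Im (c t u) * Im (c t u) <= Re (c t u) * Re (c t u)).
  { intros t u ht hru hKu. apply Rnot_lt_le. intro hlt.
    destruct (cone_of_slope e (Re (c t u)) (Im (c t u))) as [eps [heps hcone]]; [lra|easy|easy|].
    apply hno. exists eps, t. repeat split; try lra.
    exists (c t u). split; [|split].
    - exists (c t). split; [destruct k; now left|now exists u].
    - unfold Cmod. rewrite <- (sqrt_Rsqr R0) by lra. apply sqrt_lt_1_alt.
      split; [apply Rplus_le_le_0_compat; apply pow2_ge_0|].
      unfold Rsqr. fold (Re (c t u)) (Im (c t u)). lra.
    - now destruct (c t u). }
  destruct hflow as [hmcf hprof].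
  assert (ha : exists a, 0 < a /\
    forall u, a <= Re (c t0 u) * Re (c t0 u) + Im (c t0 u) * Im (c t0 u)).
  { destruct (hprof t0) as [[[hper _] [hne _]] _]; [lra|].
    destruct hmcf as [[eta [heta [hsx hsy]]] _].
    destruct (smooth_on_partials _ _ hsx) as [xt [xu [xuu hx]]].
    destruct (smooth_on_partials _ _ hsy) as [yt [yu [yuu hy]]].
    apply profile_min_distance; [easy|easy| |]; intro u; apply derivable_continuous_pt.
    - destruct (hx t0 u ltac:(lra)) as [_ [_ [h _]]].
      exists (xu t0 u). apply is_derive_Reals. exact h.
    - destruct (hy t0 u ltac:(lra)) as [_ [_ [h _]]].
      exists (yu t0 u). apply is_derive_Reals. exact h. }
  destruct ha as [a0 [ha0 hinit]].
  set (a := Rmin a0 r).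
  assert (ha : 0 < a) by now apply Rmin_glb_lt.
  assert (a <= a0) by apply Rmin_l. assert (a <= r) by apply Rmin_r.
  destruct hblowup as [_ [hlam _]].
  (* The tolerance is the barrier constant: at the real point found, the barrier is negative by
     [barrier_neg_axis] but positive by avoidance up to that same time. *)
  destruct (real_points_near_origin T k c lam s rho Sigma t0 (a * exp (- (4 / a))))
    as [t [u [ht [hy hx]]]]; try easy.
  { apply Rmult_lt_0_compat; [easy|apply exp_pos]. }
  assert (hav := barrier_avoidance T k c t0 t K r a (conj hmcf hprof) ltac:(lra) ltac:(lra) hK hr2
     ltac:(lra) hgap).
  cbv beta zeta in hav.
  assert (hpos : 0 < Re (c t u) * Re (c t u)).
  { destruct (hprof t) as [[_ [hne _]] _]; [lra|]. specialize (hne u).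
    destruct (c t u) as [p q]. simpl in *. subst q.
    destruct (Req_dec p 0) as [->|hp]; [now contradict hne|nra]. }
  specialize (hav ltac:(intro v; specialize (hinit v); lra) t u ltac:(lra)).
  rewrite hy in hav. specialize (hav ltac:(lra)).
  assert (hneg := barrier_neg_axis _ _ (conj hpos hx)). lra.
Qed.
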